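(* Let $F$ be a commutative field of characteristic $\neq 2$ and let $\mathcal{E}$ be a finite-dimensional evolution algebra over $F$. The following statements are equivalent: 1) $\mathcal{E}$ is a power-associative algebra; 2) $\mathcal{E}$ is a Jordan algebra.
   Context: An $n$-dimensional (not necessarily associative) algebra $\mathcal{E}$ over $F$ is an evolution algebra if it has a basis $\{e_1,\ldots,e_n\}$ (a natural basis) with $e_ie_j=0$ for all $i\neq j$ (and $e_i^2$ arbitrary); such an algebra is commutative. An algebra is power-associative if the subalgebra generated by each single element is associative. An algebra is Jordan if it is commutative and $(x^2y)x=x^2(yx)$ for all $x,y$. *)

(* Defs.v *)
From mathcomp Require Import all_boot all_algebra.

Set Implicit Arguments.
Unset Strict Implicit.
Unset Printing Implicit Defensive.

Import GRing.Theory.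
Local Open Scope ring_scope.

(* A finite-dimensional, not necessarily associative (nor unital) algebra over
   the field F is a vectType V over F together with a bilinear product mul on
   V.  The ring structures of the library are not used for it, since they are
   all associative. *)

Section NonAssociativeAlgebra.

Variables (F : fieldType) (V : vectType F) (mul : {bilinear V -> V -> V}).

Definition natural_basis (n : nat) (e : n.-tuple V) : Prop :=
  basis_of {:V} e /\
  forall i j : 'I_n, i != j -> mul (tnth e i) (tnth e j) = 0.

Definition evolution_algebra : Prop :=
  exists (n : nat) (e : n.-tuple V), natural_basis e.

Definition subalgebra (U : {vspace V}) : Prop :=
  forall u v : V, u \in U -> v \in U -> mul u v \in U.

(* The subalgebra generated by x, as the intersection of all subalgebras
   containing x.  In finite dimension every linear subspace of V is a
   {vspace V}, so that no subalgebra is left out. *)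
Definition in_generated_subalgebra (x w : V) : Prop :=
  forall U : {vspace V}, subalgebra U -> x \in U -> w \in U.

Definition power_associative : Prop :=
  forall x u v w : V,
    in_generated_subalgebra x u ->
    in_generated_subalgebra x v ->
    in_generated_subalgebra x w ->
    mul (mul u v) w = mul u (mul v w).

Definition jordan_algebra : Prop :=
  (forall x y : V, mul x y = mul y x) /\
  (forall x y : V, mul (mul (mul x x) y) x = mul (mul x x) (mul y x)).

End NonAssociativeAlgebra.

(* Main.v *)
(* Write [s i] for the square of the i-th natural basis vector and [w k i] for
   its k-th coordinate.  Both properties are equivalent to the equations
   [w k i * w j k * s j = delta_jk * (s i * s k)].

   Jordan: these are the coefficients of the identity, which can be separated
   by evaluating at [e i] and [e i + t * e j] with [t = 1, -1].  Conversely,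
   under these equations the [s i] span an associative ideal [S], and each
   subalgebra generated by [x] lies in the associative subspace [F x + S].

   Power-associativity: only [x^2 x^2 = x (x x^2)] is needed, evaluated at
   combinations of at most three basis vectors.  The main step is that [w i j]
   and [w j i] never are both nonzero for distinct [i] and [j].  If 3 is
   invertible, evaluating at [t = 2] as well settles this.  In characteristic 3
   such a pair forces [w i j = - w i i]; the j-th coordinate of
   [s i * s i = (w i i)^2 * s i] then produces a third index [k] forming such
   pairs with both [i] and [j], and the three together are contradictory. *)

Require Import Defs.
From mathcomp Require Import all_boot all_algebra.
From mathcomp Require Import ring.

Set Implicit Arguments.
Unset Strict Implicit.
Unset Printing Implicit Defensive.

Import GRing.Theory.

Local Open Scope ring_scope.

(* Proves [a = b] from a linear combination of hypotheses: each application
   subtracts [c] times a known equation, and [ring] checks the remainder. *)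
Lemma add_multiple (F : fieldType) (c l r a b : F) :
  l = r -> a = b + c * (l - r) -> a = b.
Proof. by move=> ->; rewrite subrr mulr0 addr0. Qed.
Arguments add_multiple {F} c {l r a b}.

Section EvolutionAlgebra.

Variables (F : fieldType) (V : vectType F) (mul : {bilinear V -> V -> V}).
Variables (n : nat) (e : n.-tuple V).
Hypothesis e_natural : natural_basis mul e.

Local Notation "x ** y" := (mul x y) (at level 40, left associativity).

Let s (i : 'I_n) : V := tnth e i ** tnth e i.
Let w (k i : 'I_n) : F := coord e k (s i).

(** * Coordinates and products in a natural basis *)

Lemma coord_natural i k : coord e k (tnth e i) = (i == k)%:R.
Proof.
have [/basis_free e_free _] := e_natural.
by rewrite (tnth_nth 0) coord_free.
Qed.

Lemma natural_decomp x : x = \sum_i coord e i x *: tnth e i.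
Proof.
have [e_basis _] := e_natural.
rewrite {1}(coord_basis e_basis (memvf x)); apply: eq_bigr => i _.
by rewrite (tnth_nth 0).
Qed.

Lemma coord_inj x y : (forall l, coord e l x = coord e l y) -> x = y.
Proof.
move=> xy; rewrite (natural_decomp x) (natural_decomp y).
by apply: eq_bigr => i _; rewrite xy.
Qed.

Lemma mul_natural i x : tnth e i ** x = coord e i x *: s i.
Proof.
have [_ e_orth] := e_natural.
rewrite {1}(natural_decomp x) linear_sumr (bigD1 i) //= linearZr_LR /= big1.
  by rewrite addr0.
by move=> j ji; rewrite linearZr_LR /= e_orth 1?eq_sym // scaler0.
Qed.

Lemma mulE x y : x ** y = \sum_i (coord e i x * coord e i y) *: s i.
Proof.
rewrite {1}(natural_decomp x) linear_sumlz; apply: eq_bigr => i _.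
by rewrite linearZl_LR /= mul_natural scalerA.
Qed.

Lemma mul_comm x y : x ** y = y ** x.
Proof. by rewrite !mulE; apply: eq_bigr => i _; rewrite mulrC. Qed.

Lemma mul_square x : x ** x = \sum_i coord e i x ^+ 2 *: s i.
Proof. by rewrite mulE. Qed.

Lemma natural_pair_square i j t : i != j ->
  (tnth e i + t *: tnth e j) ** (tnth e i + t *: tnth e j) =
  s i + t ^+ 2 *: s j.
Proof.
have [_ e_orth] := e_natural => ij.
rewrite !(linearDl, linearDr, linearZl_LR, linearZr_LR) /=.
have ji : j != i by rewrite eq_sym.
by rewrite (e_orth i j) // (e_orth j i) // !scaler0 addr0 add0r scalerA.
Qed.

(* Both implications pass through this system of equations on the structure
   constants: it collects the coefficients of [x_i ^ 2 x_j] in the Jordan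
   identity [(x^2 e_k) x = x^2 (e_k x)]. *)
Definition jordan_equations : Prop := forall i j k : 'I_n,
  (w k i * w j k) *: s j = (j == k)%:R *: (s i ** s k).

(** * The Jordan identity and the structure equations *)

Lemma jordan_natural : jordan_algebra mul -> forall x k,
  coord e k (x ** x) *: (x ** s k) = coord e k x *: (x ** x ** s k).
Proof.
case=> _ jor x k; have := jor x (tnth e k).
rewrite mul_natural (mul_comm (x ** x) (tnth e k)) mul_natural.
by rewrite linearZl_LR linearZr_LR /= mul_comm.
Qed.

Lemma jordan_jordan_equations :
  2%N \notin [pchar F] -> jordan_algebra mul -> jordan_equations.
Proof.
move=> hF jor; have n2 : 2%:R != 0 :> F by [].
have eq1 i k : (w k i * w i k) *: s i = (i == k)%:R *: (s i ** s k).
  have := jordan_natural jor (tnth e i) k.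
  by rewrite -/(s i) mul_natural scalerA coord_natural.
move=> i j k; have [->|ij] := eqVneq i j; first exact: eq1.
apply: coord_inj => l; apply: (mulfI n2).
have eq2 t : coord e l (coord e k (s i + t ^+ 2 *: s j)
      *: ((tnth e i + t *: tnth e j) ** s k)) =
    coord e l (coord e k (tnth e i + t *: tnth e j)
      *: ((s i + t ^+ 2 *: s j) ** s k)).
  by rewrite -natural_pair_square // jordan_natural.
have := eq2 1; have := eq2 (-1); have := congr1 (coord e l) (eq1 j k).
rewrite !(linearDl, linearD, linearZl_LR, linearZ_LR) /= !mul_natural.
rewrite !(linearD, linearZ_LR) /= !coord_natural -!/(w _ _) => h1 h2 h3.
(* The difference [h3 - h2] keeps the part odd in [t]; removing the diagonal case [h1] leaves twice
   the mixed equation. *)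
apply: (add_multiple (- 2%:R) h1).
apply: (add_multiple (- 1) h2); apply: (add_multiple 1 h3).
by ring.
Qed.

(** By linearity in [y], basis vectors suffice; there the identity is [chain], summed over [i] with
    coefficients [coord e i x ^+ 2]. *)
Lemma jordan_equations_jordan : jordan_equations -> jordan_algebra mul.
Proof.
move=> eqs; split=> [|x y]; first exact: mul_comm.
have chain i k : w k i *: (x ** s k) = coord e k x *: (s i ** s k).
  rewrite [x ** s k]mulE scaler_sumr (bigD1 k) //= big1 => [|j jk].
    rewrite addr0 scalerA mulrCA -scalerA -/(w k k) eqs eqxx scale1r //.
  by rewrite scalerA mulrCA -scalerA -/(w j k) eqs (negbTE jk) scale0r scaler0.
have natural k : coord e k (x ** x) *: (x ** s k) =
    coord e k x *: (x ** x ** s k).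
  rewrite mul_square linear_sum linear_sumlz scaler_suml scaler_sumr.
  apply: eq_bigr => i _; rewrite linearZ_LR linearZl_LR /= -scalerA.
  by rewrite chain !scalerA mulrC.
rewrite (mulE _ y) (mulE y x) linear_sumlz linear_sumr; apply: eq_bigr => k _.
rewrite linearZl_LR linearZr_LR /= mulrC -!scalerA -natural.
by rewrite (mul_comm (s k)).
Qed.

(** * From the structure equations to power-associativity *)

Section JordanEquations.

Hypothesis eqs : jordan_equations.

Lemma jordan_square_square i : s i ** s i = w i i ^+ 2 *: s i.
Proof. by have := eqs i i i; rewrite eqxx scale1r. Qed.

Lemma weights_antisym i k : i != k -> w k i * w i k = 0.
Proof.
move=> ik; apply/eqP; case: (eqVneq (w k i) 0) => [->|ki0].
  by rewrite mul0r.
have := congr1 (coord e k) (eqs i i k).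
by rewrite (negbTE ik) scale0r linear0 linearZ_LR /= => /eqP;
   rewrite mulf_eq0 (negbTE ki0) orbF.
Qed.

(** The product is a multiple of [s k] with factor [w k i] and, by commutativity, of [s i] with
    factor [w i k]; one factor is zero. *)
Lemma squares_orthogonal i k : i != k -> s i ** s k = 0.
Proof.
move=> ik; have := weights_antisym ik => /eqP.
have E j h : s j ** s h = (w h j * w h h) *: s h by rewrite eqs eqxx scale1r.
rewrite mulf_eq0 => /orP[] /eqP ki0; last rewrite mul_comm.
  by rewrite E ki0 mul0r scale0r.
by rewrite E ki0 mul0r scale0r.
Qed.

Lemma loop_weight i j : i != j -> (w i i * w j i) *: s j = 0.
Proof. by move=> ij; rewrite eqs eq_sym (negbTE ij) scale0r. Qed.

Lemma loop_weight_out i j : i != j -> (w j i * w j j) *: s j = 0.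
Proof. by move=> ij; rewrite eqs eqxx scale1r squares_orthogonal. Qed.

Let S : {vspace V} := <<[seq s i | i <- enum 'I_n]>>%VS.

Lemma square_in i : s i \in S.
Proof. by apply: memv_span; apply: map_f; rewrite mem_enum. Qed.

Lemma mul_in x y : x ** y \in S.
Proof.
by rewrite mulE; apply: memv_suml => i _; rewrite memvZ // square_in.
Qed.

Lemma span_squares_ind (P : V -> Prop) :
  (forall i, P (s i)) -> P 0 -> (forall c u v, P u -> P v -> P (c *: u + v)) ->
  forall z, z \in S -> P z.
Proof.
move=> Ps P0 Pc z.
rewrite /S; elim: (enum 'I_n) z => [|i r IH] z /=.
  by rewrite span_nil memv0 => /eqP->.
rewrite span_cons => /memv_addP[_ /vlineP[c ->] [v /IH Pv ->]].
exact: Pc.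
Qed.

Lemma mul_natural_square x i :
  x ** s i = \sum_j (coord e j x * w j i) *: s j.
Proof. exact: mulE. Qed.

(** For [y = s i] and [z = s k], both sides vanish if [i != k], and equal [coord e i x * w i i ^+ 3]
    times [s i] if [i = k]. *)
Lemma assoc_squares x y z :
  y \in S -> z \in S -> x ** (y ** z) = x ** y ** z.
Proof.
move=> yS zS.
move: y yS; apply: span_squares_ind => [i||c u v hu hv]; last 2 first.
- by rewrite !(linear0l, linear0r).
- by rewrite !(linearDl, linearDr, linearZl_LR, linearZr_LR) /= hu hv.
move: z zS; apply: span_squares_ind => [k||c u v hu hv]; last 2 first.
- by rewrite !linear0r.
- by rewrite !(linearDr, linearZr_LR) /= hu hv.
have -> : x ** s i ** s k = (coord e k x * w k i * w k k ^+ 2) *: s k.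
  rewrite [x ** s i]mul_natural_square linear_sumlz (bigD1 k) //=.
  rewrite big1 => [|j jk].
    by rewrite addr0 linearZl_LR /= jordan_square_square scalerA.
  by rewrite linearZl_LR /= squares_orthogonal // scaler0.
have [<-|ik] := eqVneq i k.
  rewrite jordan_square_square linearZr_LR /= mul_natural_square.
  rewrite scaler_sumr (bigD1 i) //= big1 => [|j ji].
    by rewrite addr0 scalerA mulrC.
  rewrite scalerA.
  have -> : w i i ^+ 2 * (coord e j x * w j i) =
      w i i * coord e j x * (w i i * w j i) by ring.
  by rewrite -scalerA loop_weight 1?eq_sym // scaler0.
rewrite squares_orthogonal // linear0r.
have -> : coord e k x * w k i * w k k ^+ 2 =
    coord e k x * w k k * (w k i * w k k) by ring.
by rewrite -scalerA loop_weight_out // scaler0.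
Qed.

Lemma assoc_self x z : z \in S -> x ** (x ** z) = x ** x ** z.
Proof.
move: z; apply: span_squares_ind => [i||c u v hu hv]; last 2 first.
- by rewrite !linear0r.
- by rewrite !(linearDr, linearZr_LR) /= hu hv.
have -> : x ** x ** s i = (coord e i x ^+ 2 * w i i ^+ 2) *: s i.
  rewrite [x ** x]mul_square linear_sumlz (bigD1 i) //= big1 => [|j ji].
    by rewrite addr0 linearZl_LR /= jordan_square_square scalerA.
  by rewrite linearZl_LR /= squares_orthogonal // scaler0.
have chain k j : k != j -> (w k i * w j k) *: s j = 0.
  by move=> kj; rewrite eqs eq_sym (negbTE kj) scale0r.
have step k : w k i *: (x ** s k) = (w k i * w k k * coord e k x) *: s k.
  rewrite mul_natural_square scaler_sumr (bigD1 k) //= big1 => [|j jk].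
    by rewrite addr0 scalerA; congr (_ *: _); ring.
  by rewrite scalerA mulrCA -scalerA chain 1?eq_sym // scaler0.
rewrite [x ** s i]mul_natural_square linear_sumr (bigD1 i) //= big1.
  rewrite addr0 linearZr_LR /= -[LHS]scalerA step scalerA.
  by congr (_ *: _); ring.
move=> k ki; rewrite linearZr_LR /= -scalerA step [_ * coord e k x]mulrC.
by rewrite -scalerA loop_weight_out 1?eq_sym // !scaler0.
Qed.

Lemma jordan_equations_power_associative : power_associative mul.
Proof.
move=> x.
have gen u : in_generated_subalgebra mul x u ->
    exists2 z, z \in S & exists a, u = a *: x + z.
  move=> genu.
  have /memv_addP[_ /vlineP[a ->] [z zS ->]] : u \in (<[x]> + S)%VS.
    apply: genu => [y z _ _|]; first by rewrite (subvP (addvSr _ _)) // mul_in.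
    by rewrite (subvP (addvSl _ _)) // memv_line.
  by exists z => //; exists a.
move=> _ _ _ /gen[u uS [a ->]] /gen[v vS [b ->]] /gen[z zS [c ->]].
(* The associativity lemmas have [x] on the left; commutativity moves it to the other positions. *)
have xux y : x ** y ** x = x ** (y ** x) by rewrite mul_comm [y ** x]mul_comm.
have uxx : u ** x ** x = u ** (x ** x).
  by rewrite mul_comm [u ** x]mul_comm assoc_self // mul_comm.
have uxz : u ** x ** z = u ** (x ** z).
  rewrite [u ** x]mul_comm -assoc_squares // [u ** z]mul_comm.
  by rewrite assoc_squares // mul_comm.
have uvx : u ** v ** x = u ** (v ** x).
  rewrite mul_comm [u ** v]mul_comm assoc_squares //.
  by rewrite mul_comm [x ** v]mul_comm.
apply: coord_inj => l.
rewrite !(linearDl, linearDr, linearZl_LR, linearZr_LR) /=.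
rewrite uxx uxz uvx !xux -assoc_self // -!assoc_squares //.
by rewrite !(linearD, linearZ_LR) /=; ring.
Qed.

End JordanEquations.

(** * Coefficients of the fourth-power identity *)

Lemma power_associative_fourth x : power_associative mul ->
  x ** x ** (x ** x) = x ** (x ** (x ** x)).
Proof.
move=> pa; have genx : in_generated_subalgebra mul x x by [].
by apply: (pa x x x _ genx genx) => U subU xU; apply: (subU).
Qed.

Section PowerAssociative.

Hypothesis char_neq2 : 2%N \notin [pchar F].
Hypothesis pa : power_associative mul.

Let q l i j : F := coord e l (s i ** s j).

Lemma qC l i j : q l i j = q l j i.
Proof. by rewrite /q mul_comm. Qed.

Lemma two_neq0 : 2%:R != 0 :> F.
Proof. by []. Qed.

(** Keeping [t] free lets several values of it separate the coefficients of this polynomial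
    identity. *)
Lemma pair_fourth i j l t : i != j ->
  q l i i + 2%:R * t ^+ 2 * q l i j + t ^+ 4 * q l j j =
  (w i i + t ^+ 2 * w i j) * (w i i * w l i + t * w j i * w l j) +
  t * (w j i + t ^+ 2 * w j j) * (w i j * w l i + t * w j j * w l j).
Proof.
move=> ij; have := power_associative_fourth (tnth e i + t *: tnth e j) pa.
rewrite natural_pair_square //.
move=> /(congr1 (coord e l)).
rewrite !(linearDl, linearDr, linearZl_LR, linearZr_LR) /= !mul_natural.
rewrite !(linearD, linearZ_LR) /= -!/(w _ _) -!/(q _ _ _) (qC l j i) => h.
by apply: (add_multiple 1 h); ring.
Qed.

Lemma triple_fourth i j k l u v : i != j -> i != k -> j != k ->
  u ^+ 2 = 1 -> v ^+ 2 = 1 ->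
  coord e l ((s i + s j + s k) ** (s i + s j + s k)) =
  (w i i + w i j + w i k) *
    (w i i * w l i + u * w j i * w l j + v * w k i * w l k) +
  u * (w j i + w j j + w j k) *
    (w i j * w l i + u * w j j * w l j + v * w k j * w l k) +
  v * (w k i + w k j + w k k) *
    (w i k * w l i + u * w j k * w l j + v * w k k * w l k).
Proof.
move=> ij ik jk u2 v2.
set x := tnth e i + u *: tnth e j + v *: tnth e k.
have := power_associative_fourth x pa.
have -> : x ** x = s i + s j + s k.
  rewrite /x linearDl linearDr natural_pair_square // u2 scale1r.
  have [_ e_orth] := e_natural.
  rewrite !(linearDl, linearDr, linearZl_LR, linearZr_LR) /=.
  rewrite (e_orth i k) // (e_orth j k) // (e_orth k i) 1?eq_sym //.
  rewrite (e_orth k j) 1?eq_sym // !scaler0 !addr0 !add0r scalerA.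
  by rewrite -expr2 v2 scale1r.
move=> /(congr1 (coord e l)) ->; rewrite /x.
rewrite !(linearDl, linearDr, linearZl_LR, linearZr_LR) /= !mul_natural.
rewrite !(linearD, linearZ_LR) /= -!/(w _ _).
by ring.
Qed.

Lemma square_square i : s i ** s i = w i i ^+ 2 *: s i.
Proof.
have := power_associative_fourth (tnth e i) pa.
by rewrite -/(s i) !mul_natural linearZ_LR.
Qed.

Lemma pair_even i j l : i != j ->
  2%:R * q l i j = w i i * w i j * w l i + w j j * w j i * w l j.
Proof.
move=> ij; apply: (mulfI two_neq0).
have h1 := pair_fourth l 1 ij; have h2 := pair_fourth l (-1) ij.
have := congr1 (coord e l) (square_square i).
have := congr1 (coord e l) (square_square j).
rewrite !linearZ_LR /= -!/(q _ _ _) -!/(w _ _) => h3 h4.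
apply: (add_multiple 1 h1); apply: (add_multiple 1 h2).
apply: (add_multiple (- 2%:R) h3); apply: (add_multiple (- 2%:R) h4).
by ring.
Qed.

Lemma pair_odd i j l : i != j ->
  w i j * (w j j + w j i) * w l i + w j i * (w i i + w i j) * w l j = 0.
Proof.
move=> ij; apply: (mulfI two_neq0).
have h1 := pair_fourth l 1 ij; have h2 := pair_fourth l (-1) ij.
apply: (add_multiple (- 1) h1); apply: (add_multiple 1 h2).
by ring.
Qed.

(* The left-hand side of [triple_fourth] does not depend on the signs [u] and
   [v], so an alternating sum isolates the coefficient of [u * v]. *)
Lemma triple_mixed i j k l : i != j -> i != k -> j != k ->
  w j i * w k j * w l k + w k i * w j k * w l j = 0.
Proof.
move=> ij ik jk; apply: (mulfI two_neq0); apply: (mulfI two_neq0).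
have one2 : 1 ^+ 2 = 1 :> F by rewrite expr1n.
have mone2 : (- 1) ^+ 2 = 1 :> F by rewrite sqrrN expr1n.
have h1 := triple_fourth l ij ik jk one2 one2.
have h2 := triple_fourth l ij ik jk one2 mone2.
have h3 := triple_fourth l ij ik jk mone2 one2.
have h4 := triple_fourth l ij ik jk mone2 mone2.
(* The coefficient of [u * v] also contains the terms of [pair_odd] for [j] and [k], which are
   removed here. *)
have h5 := pair_odd l jk.
apply: (add_multiple (- 1) h1); apply: (add_multiple 1 h2).
apply: (add_multiple 1 h3); apply: (add_multiple (- 1) h4).
apply: (add_multiple (- 4%:R) h5).
by ring.
Qed.

(** * Excluding reciprocal nonzero weights *)

Lemma reciprocal_weights_char3 i j : 3%:R = 0 :> F -> i != j ->
  w i j != 0 -> w j i != 0 -> w i i != 0 /\ w i j = - w i i.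
Proof.
move=> c3 ij wij wji.
have hi : w i i * w j j + 2%:R * w i i * w j i + w j i * w i j = 0.
  by apply: (mulfI wij); apply: (add_multiple 1 (pair_odd i ij)); ring.
have hj : w i i * w j j + 2%:R * w j j * w i j + w j i * w i j = 0.
  by apply: (mulfI wji); apply: (add_multiple 1 (pair_odd j ij)); ring.
have wii : w i i != 0.
  apply: contraNneq (mulf_neq0 wji wij) => wii0.
  by move: hi; rewrite wii0 !(mulr0, mul0r, add0r) => ->.
have wjj : w j j != 0.
  apply: contraNneq (mulf_neq0 wji wij) => wjj0.
  by move: hj; rewrite wjj0 !(mulr0, mul0r, add0r) => ->.
(* Modulo 3, [(w i i - w i j)] times [hj] plus [w i j] times [hi] has left-hand side
   [w j j * (w i i + w i j) ^+ 2]. *)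
split=> //; apply/eqP; rewrite -addr_eq0 -sqrf_eq0; apply/eqP.
apply: (mulfI wjj); apply: (add_multiple (w i i - w i j) hj).
apply: (add_multiple (w i j) hi).
apply: (add_multiple (w j j * w i j ^+ 2 - w i i * w i j * w j i) c3).
by ring.
Qed.

Lemma no_reciprocal_weights_char3 i j :
  3%:R = 0 :> F -> i != j -> w i j * w j i = 0.
Proof.
move=> c3 ij; apply/eqP/idPn; rewrite mulf_eq0 negb_or => /andP[wij wji].
have ji : j != i by rewrite eq_sym.
have [wii Eij] := reciprocal_weights_char3 c3 ij wij wji.
have [wjj Eji] := reciprocal_weights_char3 c3 ji wji wij.
have [k /and3P[ki kj]|none] :=
    pickP [pred k | [&& k != i, k != j & w k i * w j k != 0]]; last first.
  (* The term at [i] cancels the right-hand side; with no third index only the nonzero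
     [w j i ^+ 2 * w j j] would remain. *)
  have := congr1 (coord e j) (square_square i).
  rewrite mul_square linear_sum /= (bigD1 i) //= (bigD1 j) //= big1 => [|k].
    rewrite addr0 !linearZ_LR /= -!/(w _ _) => /(canRL (addKr _)).
    rewrite addNr => /eqP; rewrite mulf_eq0 expf_eq0 /=.
    by rewrite (negbTE wji) (negbTE wjj).
  case/andP=> ki kj; have /eqP := none k.
  rewrite /= ki kj /= eqbF_neg negbK mulf_eq0 linearZ_LR /= -!/(w _ _).
  by case/orP=> /eqP->; rewrite ?expr0n ?mul0r ?mulr0.
rewrite mulf_eq0 negb_or => /andP[wki wjk].
have ik : i != k by rewrite eq_sym.
have jk : j != k by rewrite eq_sym.
(* [triple_mixed] at [l = j] and [l = i] leads to [w i k = w i i], whereas the reciprocal pair [i],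
   [k] forces [w i k = - w i i]. *)
have Ekj : w k j = w k i.
  apply: (mulfI (mulf_neq0 wjj wjk)).
  apply: (add_multiple (- 1) (triple_mixed j ij ik jk)); rewrite Eji.
  by ring.
have wkj : w k j != 0 by rewrite Ekj.
have [_ Ejk] := reciprocal_weights_char3 c3 jk wjk wkj.
have Eik : w i k = w i i.
  apply: (mulfI (mulf_neq0 wjj wki)).
  apply: (add_multiple (- 1) (triple_mixed i ij ik jk)).
  by rewrite Eji Ejk Ekj Eij; ring.
have wik : w i k != 0 by rewrite Eik.
have [_] := reciprocal_weights_char3 c3 ik wik wki.
rewrite Eik => /eqP; rewrite -addr_eq0 -mulr2n -mulr_natl mulf_eq0.
by rewrite (negbTE two_neq0) (negbTE wii).
Qed.

Lemma no_reciprocal_weights i j : i != j -> w i j * w j i = 0.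
Proof.
move=> ij; have [c3|c3] := eqVneq (3%:R : F) 0.
  exact: no_reciprocal_weights_char3.
(* This is the coefficient of [t ^+ 3]: the odd parts at 1 and 2 separate it from that of [t], up to
   the factor 12. *)
have cubic l : w i j * (w j j * w l i + w j i * w l j) = 0.
  apply: (mulfI two_neq0); apply: (mulfI two_neq0); apply: (mulfI c3).
  have h1 := pair_fourth l 2%:R ij; have h2 := pair_fourth l (- 2%:R) ij.
  apply: (add_multiple (- 1) h1); apply: (add_multiple 1 h2).
  by apply: (add_multiple (- 4%:R) (pair_odd l ij)); ring.
have [->|wij] := eqVneq (w i j) 0; first by rewrite mul0r.
have [->|wji] := eqVneq (w j i) 0; first by rewrite mulr0.
have wjj : w j j = 0.
  apply: (mulfI wji); apply: (mulfI two_neq0); apply: (mulfI wij).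
  by apply: (add_multiple 1 (cubic j)); ring.
by apply: (mulfI wij); apply: (add_multiple 1 (cubic i)); rewrite wjj; ring.
Qed.

(** * Vanishing of path products and of products of distinct squares *)

Lemma loop_weight_zero i j l : i != j -> w j j * w i j * w l i = 0.
Proof.
move=> ij; have /eqP := no_reciprocal_weights ij.
rewrite mulf_eq0 => /orP[] /eqP w0; first by rewrite w0 mulr0 mul0r.
by apply: (add_multiple 1 (pair_odd l ij)); rewrite w0; ring.
Qed.

(** If [w j k] is nonzero then [w k j = 0], which kills the other term of [triple_mixed]. *)
Lemma path_weight_zero i j k l : j != k -> w k i * w j k * w l j = 0.
Proof.
move=> jk; have [->|ik] := eqVneq i k; first exact: loop_weight_zero.
have [->|ij] := eqVneq i j.
  by rewrite no_reciprocal_weights 1?eq_sym // mul0r.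
have /eqP := no_reciprocal_weights jk.
rewrite mulf_eq0 => /orP[] /eqP w0; first by rewrite w0 mulr0 mul0r.
by apply: (add_multiple 1 (triple_mixed l ij ik jk)); rewrite w0; ring.
Qed.

(** Multiplied by [w i k], each term with [j != i] of the expansion contains a vanishing path
    product. *)
Lemma square_mul_weight i k l : i != k -> w i k != 0 ->
  q l i k = w i i * w i k * w l i.
Proof.
move=> ik wik; rewrite /q mulE linear_sum (bigD1 i) //= big1 => [|j ji].
  by rewrite addr0 linearZ_LR.
rewrite linearZ_LR /= -!/(w _ _); apply: (mulfI wik).
have := path_weight_zero k l ji => h.
by apply: (add_multiple (w j k) h); ring.
Qed.

(** When [w a b] is nonzero, [pair_even] gives [2 * q l a b] the same value that [square_mul_weight]
    gives [q l a b]. *)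
Lemma squares_mul_zero i k l : i != k -> q l i k = 0.
Proof.
move=> ik.
have oriented a b : a != b -> w a b != 0 -> q l a b = 0.
  move=> ab wab; have /eqP := no_reciprocal_weights ab.
  rewrite mulf_eq0 (negbTE wab) => /eqP wba.
  apply: (add_multiple 1 (pair_even l ab)).
  apply: (add_multiple (- 1) (square_mul_weight l ab wab)).
  by rewrite wba; ring.
have [wik|wik] := eqVneq (w i k) 0; last exact: oriented.
have [wki|wki] := eqVneq (w k i) 0; last by rewrite qC oriented // eq_sym.
apply: (mulfI two_neq0); apply: (add_multiple 1 (pair_even l ik)).
by rewrite wik wki; ring.
Qed.

Lemma power_associative_jordan_equations : jordan_equations.
Proof.
move=> i j k; apply: coord_inj => l; rewrite !linearZ_LR /= -/(w l j).
have [->|jk] := eqVneq j k; last by rewrite mul0r path_weight_zero.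
rewrite mul1r; have [->|ik] := eqVneq i k.
  by rewrite square_square linearZ_LR.
have ki : k != i by rewrite eq_sym.
rewrite -/(q l i k) squares_mul_zero //.
have [->|wki] := eqVneq (w k i) 0; first by rewrite !mul0r.
by rewrite [w k i * _]mulrC -square_mul_weight // squares_mul_zero.
Qed.

End PowerAssociative.
End EvolutionAlgebra.

Theorem theorem3p5p5 (F : fieldType) (hF : 2%N \notin [pchar F])
    (V : vectType F) (mul : {bilinear V -> V -> V})
    (hE : evolution_algebra mul) :
  power_associative mul <-> jordan_algebra mul.
Proof.
have [n [e e_natural]] := hE; split=> [pa|jor].
  apply: (jordan_equations_jordan e_natural).
  exact: power_associative_jordan_equations.
apply: (jordan_equations_power_associative e_natural).
exact: jordan_jordan_equations.
Qed.
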